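(* Consider all tuples $(K,E_1,O_1,\pi_1,E_2,O_2,\pi_2)$ where $K$ is a field of characteristic $0$, $(E_i,O_i)$ is an elliptic curve over $K$ with origin $O_i$, and $\pi_i\in K(E_i)$ is an even morphism $E_i\to\mathbb{P}^1$ of degree $2$ ($i=1,2$), such that $\pi_1(E_1[2])\neq\pi_2(E_2[2])$. Then \[ \sup_{\{(K,E_1,O_1,\pi_1,E_2,O_2,\pi_2):\ \pi_1(E_1[2])\neq\pi_2(E_2[2])\}}\#\big(\pi_1(E_1[\infty])\cap\pi_2(E_2[\infty])\big)\ \geq\ 14 . \]
   Context: For an elliptic curve $(E,O)$ over $K$, $E[n]$ denotes the set of $n$-torsion points (over an algebraic closure $\bar K$) with respect to the group law with identity $O$, and $E[\infty]$ the set of all torsion points. A morphism $\pi:E\to\mathbb{P}^1$ is called even if $\pi(-P)=\pi(P)$ for all $P$, where $-P$ is the inverse for the group law with identity $O$. *)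

(* Defs.v *)
From HB Require Import structures.
From mathcomp Require Import all_boot all_order all_algebra all_field.
(* Without its notations, which clash with those of MathComp-Analysis:
   mpoly 3 K is {mpoly K[3]}, and ishomog1 d mdeg is d.-homog. *)
From mathcomp Require Import -(notations) mpoly.
From mathcomp Require Import boolp classical_sets functions cardinality.
From mathcomp Require Import reals constructive_ereal ereal counting_measure.
From mathcomp Require Import zify.

Set Implicit Arguments.
Unset Strict Implicit.
Unset Printing Implicit Defensive.

Import GRing.Theory.

Local Open Scope classical_set_scope.
Local Open Scope ring_scope.

(* The cubic  y^2 + a1 x y + a3 y = x^3 + a2 x^2 + a4 x + a6. *)
Record weierstrass (R : Type) :=
  Weierstrass { a1 : R; a2 : R; a3 : R; a4 : R; a6 : R }.

Definition map_weierstrass (R S : Type) (f : R -> S) (W : weierstrass R) :=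
  Weierstrass (f (a1 W)) (f (a2 W)) (f (a3 W)) (f (a4 W)) (f (a6 W)).

Definition discriminant (R : comNzRingType) (W : weierstrass R) : R :=
  let b2 := a1 W ^+ 2 + 4 * a2 W in
  let b4 := 2 * a4 W + a1 W * a3 W in
  let b6 := a3 W ^+ 2 + 4 * a6 W in
  let b8 := a1 W ^+ 2 * a6 W + 4 * a2 W * a6 W - a1 W * a3 W * a4 W
            + a2 W * a3 W ^+ 2 - a4 W ^+ 2 in
  - b2 ^+ 2 * b8 - 8 * b4 ^+ 3 - 27 * b6 ^+ 2 + 9 * b2 * b4 * b6.

(* An elliptic curve (E, O) over K, given by a Weierstrass equation; O is the
   point at infinity [0 : 1 : 0]. *)
Record elliptic_curve (K : fieldType) := EllipticCurve {
  equation :> weierstrass K;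
  nonsingular : discriminant equation != 0 }.

Section Points.
Context {L : fieldType}.

Inductive point := Infinity | Affine of L & L.

Definition proj_coord (P : point) : 'I_3 -> L :=
  match P with
  | Infinity => tnth [tuple 0; 1; 0]
  | Affine x y => tnth [tuple x; y; 1]
  end.

Variable W : weierstrass L.

Definition on_curve (P : point) : bool :=
  match P with
  | Infinity => true
  | Affine x y => y ^+ 2 + a1 W * x * y + a3 W * y
                  == x ^+ 3 + a2 W * x ^+ 2 + a4 W * x + a6 W
  end.

(* The chord-and-tangent law with identity Infinity. Outside the curve the
   values of these formulas are irrelevant. *)
Definition opp_point (P : point) : point :=
  match P with
  | Infinity => Infinity
  | Affine x y => Affine x (- y - a1 W * x - a3 W)
  end.

Definition slope (x1 y1 x2 y2 : L) : L :=
  if x1 == x2 then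
    (3 * x1 ^+ 2 + 2 * a2 W * x1 + a4 W - a1 W * y1)
      / (2 * y1 + a1 W * x1 + a3 W)
  else (y2 - y1) / (x2 - x1).

Definition add_point (P Q : point) : point :=
  match P, Q with
  | Infinity, _ => Q
  | _, Infinity => P
  | Affine x1 y1, Affine x2 y2 =>
    if (x1 == x2) && (y1 == - y2 - a1 W * x2 - a3 W) then Infinity
    else
      let l := slope x1 y1 x2 y2 in
      let x3 := l ^+ 2 + a1 W * l - a2 W - x1 - x2 in
      let y3 := l * (x3 - x1) + y1 in
      opp_point (Affine x3 y3)
  end.

Definition muln_point (n : nat) (P : point) : point :=
  iter n (add_point P) Infinity.

Definition torsion (n : nat) : set point :=
  [set P | on_curve P /\ muln_point n P = Infinity].

Definition all_torsion : set point :=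
  \bigcup_(n in [set n | (0 < n)%N]) torsion n.

End Points.
Arguments point : clear implicits.

(* The projective line over L is  L + {infinity}: None stands for [1 : 0], and
   Some c for [c : 1]. *)
Definition P1 (L : choiceType) : choiceType := option L.

Definition P1_point (L : fieldType) (s t : L) : P1 L :=
  if t == 0 then None else Some (s / t).

Section Quadratic.
Variables (F : fieldType) (b c : F).

Lemma size_quadratic : size ('X^2 + b *: 'X - c%:P) = 3%N.
Proof.
rewrite -addrA size_polyDl ?size_polyXn //.
rewrite ltnS (leq_trans (size_polyD _ _)) // geq_max.
rewrite (leq_trans (size_scale_leq _ _)) ?size_polyX //=.
by rewrite size_polyN (leq_trans (size_polyC_leq1 _)).
Qed.

Lemma quadratic_monic : 'X^2 + b *: 'X - c%:P \is monic.
Proof.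
rewrite monicE lead_coefE size_quadratic /=.
by rewrite coefB coefD coefXn coefZ coefX coefC /= mulr0 addr0 subr0.
Qed.

Lemma quadratic_irreducible :
  (forall r, r * (r + b) <> c) -> irreducible_poly ('X^2 + b *: 'X - c%:P).
Proof.
move=> noroot; apply: cubic_irreducible; first by rewrite size_quadratic.
move=> r; apply/negP => /rootP; rewrite !hornerE => rE; apply: (noroot r).
by apply/eqP; rewrite -subr_eq0 mulrDr -expr2 [r * b]mulrC rE.
Qed.

End Quadratic.

Lemma fraction_numden (R : idomainType) (r : {fraction R}) :
  exists n d : R, d != 0 /\ r * tofrac d = tofrac n.
Proof.
elim/quotW: r => x; exists \n_x, \d_x; split; first exact: denom_ratioP.
unlock FracField.tofrac.
rewrite !piE; apply/eqP; rewrite eqmodE /= FracField.equivfE.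
rewrite /FracField.mulf /= !numden_Ratio ?oner_eq0 ?mulr1 ?denom_ratioP //.
by rewrite mulrC.
Qed.
Section NoRoot.
Variables (K : fieldType) (b c : {poly K}).
Hypotheses (sb : (size b <= 2)%N) (sc : size c = 4%N).

Lemma no_fraction_root (r : {fraction {poly K}}) :
  r * (r + tofrac b) <> tofrac c.
Proof.
move=> rE; have [n [d [d0 rd]]] := fraction_numden r.
have : n * (n + b * d) == c * (d * d).
  rewrite -tofrac_eq !tofracM tofracD tofracM -rd -rE.
  by rewrite -mulrDl mulrACA.
move/eqP => nE; have c0 : c != 0 by rewrite -size_poly_gt0 sc.
have := congr1 (fun p : {poly K} => size p) nE.
rewrite (size_mul c0) ?mulf_neq0 // sc (size_mul d0 d0).
have sd : (0 < size d)%N by rewrite size_poly_gt0.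
have sbd : (size (b * d)%R <= size d + 1)%N.
  apply: leq_trans (size_polyMleq b d) _.
  by move: (size b) (size d) sb; lia.
case: (ltnP (size d + 1) (size n)) => snd.
  have s1 : size (n + b * d) = size n by rewrite size_polyDl // (leq_ltn_trans sbd).
  have n0 : n != 0 by rewrite -size_poly_gt0; apply: leq_ltn_trans snd.
  rewrite size_mul // -?size_poly_gt0 s1; last by apply: leq_ltn_trans snd.
  by move: (size n) (size d) snd sd; lia.
have := size_polyMleq n (n + b * d).
have : (size (n + b * d)%R <= size d + 1)%N.
  by rewrite (leq_trans (size_polyD _ _)) // geq_max snd.
by move: (size n) (size d) (size (n + b * d)) (size (n * _)) snd sd; lia.
Qed.
End NoRoot.

Section FunctionField.
Context {K : fieldType}.
Variable E : weierstrass K.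

(* The Weierstrass equation, as a polynomial in y over the field K(x). *)
Definition function_field_poly : {poly {fraction {poly K}}} :=
  'X^2 + tofrac (a1 E *: 'X + (a3 E)%:P) *: 'X
  - (tofrac ('X^3 + a2 E *: 'X^2 + a4 E *: 'X + (a6 E)%:P))%:P.

Lemma function_field_polyP : monic_irreducible_poly function_field_poly.
Proof.
split; last exact: quadratic_monic.
apply: quadratic_irreducible; apply: no_fraction_root.
  rewrite (leq_trans (size_polyD _ _)) // geq_max.
  rewrite (leq_trans (size_scale_leq _ _)) ?size_polyX //=.
  by rewrite (leq_trans (size_polyC_leq1 _)).
rewrite -!addrA size_polyDl ?size_polyXn // ltnS.
do 2![rewrite (leq_trans (size_polyD _ _)) // geq_max
              (leq_trans (size_scale_leq _ _)) ?size_polyXn ?size_polyX //=].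
by rewrite (leq_trans (size_polyC_leq1 _)).
Qed.

(* K(E) = K(x)[y] / (Weierstrass equation). *)
Definition function_field : fieldType :=
  {poly %/ function_field_poly with function_field_polyP}.

Definition ff_const (c : K) : function_field :=
  in_qpoly function_field_poly (tofrac c%:P)%:P.
Definition ff_x : function_field := in_qpoly function_field_poly (tofrac 'X)%:P.
Definition ff_y : function_field := in_qpoly function_field_poly 'X.

(* The subfield K(f) of K(E). *)
Definition generated_subfield (f : function_field) : set function_field :=
  [set z | exists p q : {poly K},
     (map_poly ff_const q).[f] != 0 /\
     z = (map_poly ff_const p).[f] / (map_poly ff_const q).[f]].

(* [K(E) : k] = d, for a subfield k of K(E): there is a k-basis of K(E) with d
   elements. *)
Definition extension_degree (k : set function_field) (d : nat) : Prop :=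
  exists e : 'I_d -> function_field, forall z : function_field,
    exists! c : {ffun 'I_d -> function_field},
      (forall i, k (c i)) /\ z = \sum_(i < d) c i * e i.

End FunctionField.

(* iota : K -> Kbar is an algebraic closure. *)
Definition is_algebraic_closure (K : fieldType) (Kbar : closedFieldType)
    (iota : {rmorphism K -> Kbar}) : Prop :=
  forall z : Kbar, algebraicOver iota z.

Section Morphisms.
Context {K : fieldType} {Kbar : closedFieldType}.
Variable iota : {rmorphism K -> Kbar}.
Variable E : elliptic_curve K.

Definition geometric_curve : weierstrass Kbar := map_weierstrass iota E.

(* f = F / G in K(E), and at P, where F and G do not both vanish, phi takes the
   value [F(P) : G(P)]; F and G are meant to be forms of the same degree. *)
Definition represents (f : function_field E) (phi : point Kbar -> P1 Kbar)
    (P : point Kbar) (F G : mpoly 3 K) : Prop :=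
  let ev := mmap iota (proj_coord P) in
  let ff := mmap (ff_const E) (tnth [tuple ff_x E; ff_y E; 1]) in
  [/\ ff G != 0 /\ f = ff F / ff G,
      ~~ ((ev F == 0) && (ev G == 0))
    & phi P = P1_point (ev F) (ev G)].

(* A morphism E -> P^1 over K, other than the constant infinity: an element f
   of K(E), together with the map it induces on Kbar-points. *)
Record morphism_P1 := MorphismP1 {
  pullback : function_field E;
  map_points :> point Kbar -> P1 Kbar;
  regular : forall P, on_curve geometric_curve P ->
    exists (d : nat) (F G : mpoly 3 K),
      [/\ F \is ishomog1 d mdeg, G \is ishomog1 d mdeg
        & represents pullback map_points P F G] }.

(* deg pi = [K(E) : pi^* K(P^1)] *)
Definition has_degree (pi : morphism_P1) (d : nat) : Prop :=
  extension_degree (generated_subfield (pullback pi)) d.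

Definition even_morphism (pi : morphism_P1) : Prop :=
  forall P, on_curve geometric_curve P ->
    pi (opp_point geometric_curve P) = pi P.

Definition torsion_image (pi : morphism_P1) (n : nat) : set (P1 Kbar) :=
  pi @` torsion geometric_curve n.

Definition all_torsion_image (pi : morphism_P1) : set (P1 Kbar) :=
  pi @` all_torsion geometric_curve.

End Morphisms.

(* Main.v *)
(* Both curves are the curve E : y^2 = x^3 + 1 over an algebraically closed
   field, with pi1 = x and pi2 = -2/x. Translations by E[2] act on the x-line
   as a Klein four-group V, and x |-> -2/x normalises V. It permutes the six
   fixed points of the involutions in V, which are the images of the points of
   order 4, and it exchanges x(E[2]) = {oo, -1, -w, -w^2}, where w is a
   primitive cube root of unity, with {0, 2, 2w, 2w^2}, the V-orbit of the
   image 0 of two points of order 3. So these 6 + 4 + 4 = 14 points lie in both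
   torsion images. *)
Require Import Defs.
From HB Require Import structures.
From mathcomp Require Import all_boot all_order all_algebra all_field.
From mathcomp Require Import -(notations) mpoly.
From mathcomp Require Import boolp classical_sets cardinality.
From mathcomp Require Import reals constructive_ereal ereal.
From mathcomp Require Import counting_measure.
From mathcomp Require Import ring.

Set Implicit Arguments.
Unset Strict Implicit.
Unset Printing Implicit Defensive.

Import Order.TTheory GRing.Theory Num.Theory.

Local Open Scope classical_set_scope.
Local Open Scope ring_scope.

(** * Polynomial identities and subfields generated by one element *)

Lemma rmorph_cubic (K : fieldType) (L : comNzRingType)
    (f : {rmorphism {poly K} -> L}) (a b c : K) :
  f ('X^3 + a *: 'X^2 + b *: 'X + c%:P)
  = f 'X ^+ 3 + f a%:P * f 'X ^+ 2 + f b%:P * f 'X + f c%:P.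
Proof. by rewrite -!mul_polyC !rmorphD !rmorphM. Qed.

Lemma coef_linear_poly (R : nzRingType) (r s : R) (i : nat) :
  (r%:P + s%:P * 'X)`_i = if i == 0%N then r else if i == 1%N then s else 0.
Proof.
by rewrite coefD coefMX !coefC; case: i => [|[|i]]; rewrite /= ?addr0 ?add0r.
Qed.

Lemma linear_polyE (R : nzRingType) (p : {poly R}) :
  (size p <= 2)%N -> p = (p`_0)%:P + (p`_1)%:P * 'X.
Proof.
move=> sp; apply/polyP => i; rewrite coef_linear_poly.
by case: i => [|[|i]] //=; rewrite nth_default // (leq_trans sp).
Qed.

(* generated_subfield for an arbitrary field L in place of K(E): in the concrete
   quotient ring, simplification and conversion do not terminate in practice. *)
Section AdjoinedField.
Context {K L : fieldType} (f : {rmorphism K -> L}).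

Definition adjoined_field (u : L) : set L :=
  [set z | exists p q : {poly K}, (map_poly f q).[u] != 0 /\
     z = (map_poly f p).[u] / (map_poly f q).[u]].

(* p' is X^n p(c / X). *)
Lemma horner_inversion (c : K) (p : {poly K}) : exists (p' : {poly K}) n,
  forall u : L, u != 0 ->
    (map_poly f p).[f c / u] = (map_poly f p').[u] / u ^+ n.
Proof.
elim/poly_ind: p => [|p a [p' [n IHp]]].
  by exists 0, 0%N => u _; rewrite !rmorph0 !horner0 mul0r.
exists (c *: p' + a *: 'X^(n.+1)), n.+1 => u u0.
rewrite !rmorphD !rmorphM /= map_polyX map_polyC /= !hornerE IHp //.
rewrite !map_polyZ map_polyXn /= !hornerE !exprS /=.
have un0 : u ^+ n != 0 by rewrite expf_neq0.
by field; rewrite un0 u0.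
Qed.

Lemma sub_adjoined_field_inversion (c : K) (u : L) : c != 0 -> u != 0 ->
  adjoined_field (f c / u) `<=` adjoined_field u.
Proof.
move=> c0 u0 z [p [q [q0 ->]]].
have [p' [n pE]] := horner_inversion c p.
have [q' [m qE]] := horner_inversion c q.
move: q0; rewrite pE // qE // mulf_eq0 invr_eq0 negb_or => /andP [q'0 um0].
(* Clears denominators in p'(u) / u^n over q'(u) / u^m. *)
exists (p' * 'X^m), (q' * 'X^n); rewrite !rmorphM /= !map_polyXn !hornerE.
have un0 : u ^+ n != 0 by rewrite expf_neq0.
by split; [rewrite mulf_neq0 | field; rewrite um0 un0 q'0].
Qed.

(** The map u |-> [f c / u] is an involution, so one inclusion gives both. *)
Lemma adjoined_field_inversion (c : K) (u : L) : c != 0 -> u != 0 ->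
  adjoined_field (f c / u) = adjoined_field u.
Proof.
move=> c0 u0; apply/seteqP; split; first exact: sub_adjoined_field_inversion.
have fc0 : f c != 0 by rewrite fmorph_eq0.
have {1}-> : u = f c / (f c / u) by field; rewrite u0 fc0.
by apply: sub_adjoined_field_inversion; rewrite ?mulf_neq0 ?invr_eq0.
Qed.

Lemma adjoined_field_range (phi : {rmorphism {fraction {poly K}} -> L}) :
  (forall a, phi (tofrac a%:P) = f a) ->
  adjoined_field (phi (tofrac 'X)) = range phi.
Proof.
move=> phiC.
have horner_phi (p : {poly K}) :
    (map_poly f p).[phi (tofrac 'X)] = phi (tofrac p).
  elim/poly_ind: p => [|p c IHp]; first by rewrite !rmorph0 horner0.
  by rewrite !rmorphD !rmorphM /= map_polyX map_polyC /= !hornerE IHp phiC.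
apply/seteqP; split=> z /=.
  move=> [p [q [_ ->]]]; exists (tofrac p / tofrac q) => //.
  by rewrite !horner_phi fmorph_div.
move=> [r _ <-]; have [n [d [d0 rd]]] := fraction_numden r.
exists n, d; rewrite !horner_phi fmorph_eq0 tofrac_eq0; split=> //.
by rewrite -rd rmorphM mulfK // fmorph_eq0 tofrac_eq0.
Qed.

End AdjoinedField.

(** * The function field as a quadratic extension of K(x) *)

Section FunctionField.
Context {K : fieldType} (E : weierstrass K).

Local Notation h := (function_field_poly E).
Local Notation FE := (function_field E).

Definition ff_ratfun (r : {fraction {poly K}}) : FE := in_qpoly h r%:P.

Fact ff_ratfun_zmod_morphism : zmod_morphism ff_ratfun.
Proof. by move=> r s; rewrite /ff_ratfun !rmorphB. Qed.
HB.instance Definition _ := GRing.isZmodMorphism.Build _ _ ff_ratfun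
  ff_ratfun_zmod_morphism.

Fact ff_ratfun_monoid_morphism : monoid_morphism ff_ratfun.
Proof.
by split=> [|r s]; rewrite /ff_ratfun; [exact: in_qpoly1 | rewrite !rmorphM].
Qed.
HB.instance Definition _ := GRing.isMonoidMorphism.Build _ _ ff_ratfun
  ff_ratfun_monoid_morphism.

Lemma ff_constE (a : K) : ff_const E a = ff_ratfun (tofrac a%:P).
Proof. by []. Qed.

Lemma ff_xE : ff_x E = ff_ratfun (tofrac 'X).
Proof. by []. Qed.

Fact ff_const_zmod_morphism : zmod_morphism (ff_const E).
Proof. by move=> a b; rewrite !ff_constE !rmorphB. Qed.
HB.instance Definition _ := GRing.isZmodMorphism.Build _ _ (ff_const E)
  ff_const_zmod_morphism.

Fact ff_const_monoid_morphism : monoid_morphism (ff_const E).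
Proof. by split=> [|a b]; rewrite !ff_constE ?rmorph1 // !rmorphM. Qed.
HB.instance Definition _ := GRing.isMonoidMorphism.Build _ _ (ff_const E)
  ff_const_monoid_morphism.

Lemma size_function_field_poly : size h = 3%N.
Proof. exact: size_quadratic. Qed.

(** The quotient is taken modulo [mk_monic h], which replaces an unsuitable modulus by a default;
    [h] is monic of degree 2 and stays. *)
Lemma mk_monic_function_field_poly : mk_monic h = h.
Proof. by rewrite /mk_monic size_function_field_poly quadratic_monic. Qed.

Lemma ff_x_neq0 : ff_x E != 0.
Proof. by rewrite ff_xE fmorph_eq0 tofrac_eq0 polyX_eq0. Qed.

(** [h] vanishes in the quotient by [h]; expanding its image under the ring morphism [in_qpoly h]
    gives the equation. *)
Lemma ff_equation :
  let x := ff_x E in let y := ff_y E in let c := ff_const E in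
  y ^+ 2 + c (a1 E) * x * y + c (a3 E) * y
  = x ^+ 3 + c (a2 E) * x ^+ 2 + c (a4 E) * x + c (a6 E).
Proof.
move=> x y c; apply/eqP; rewrite -subr_eq0.
have h0 : in_qpoly h h = 0.
  apply: val_inj => /=; rewrite mk_monic_function_field_poly.
  by apply: Pdiv.RingMonic.rmodpp; exact: quadratic_monic.
pose b := a1 E *: 'X + (a3 E)%:P.
pose g := 'X^3 + a2 E *: 'X^2 + a4 E *: 'X + (a6 E)%:P.
have hE : in_qpoly h h
    = y ^+ 2 + ff_ratfun (tofrac b) * y - ff_ratfun (tofrac g).
  rewrite [X in in_qpoly _ X]/function_field_poly rmorphB rmorphD rmorphXn /=.
  by rewrite -mul_polyC rmorphM.
have bE : ff_ratfun (tofrac b) = c (a1 E) * x + c (a3 E).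
  by rewrite /b -mul_polyC !rmorphD !rmorphM.
have gE : ff_ratfun (tofrac g)
    = x ^+ 3 + c (a2 E) * x ^+ 2 + c (a4 E) * x + c (a6 E).
  exact: (rmorph_cubic (ff_ratfun \o @tofrac _)).
by rewrite -h0 hE bE gE mulrDl addrA.
Qed.

(** A polynomial of degree at most 1 is its own remainder modulo the quadratic [h]. *)
Lemma ratfun_basisE (r s : {fraction {poly K}}) :
  ff_ratfun r + ff_ratfun s * ff_y E = r%:P + s%:P * 'X :> {poly _}.
Proof.
rewrite /ff_ratfun /ff_y -rmorphM -rmorphD in_qpoly_small //.
rewrite mk_monic_function_field_poly size_function_field_poly.
rewrite addrC size_MXaddC; case: ifP => // _.
by rewrite ltnS (leq_ltn_trans (size_polyC_leq1 _)).
Qed.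

Lemma generated_subfield_xE :
  generated_subfield (ff_x E) = range ff_ratfun.
Proof. exact: (adjoined_field_range (fun a => esym (ff_constE a))). Qed.

Lemma generated_subfield_inversion (c : K) (u : FE) : c != 0 -> u != 0 ->
  generated_subfield (ff_const E c / u) = generated_subfield u.
Proof. exact: (adjoined_field_inversion (ff_const E)). Qed.

(** The basis is 1, y: the coordinates of [z] are the two coefficients of its reduced
    representative. *)
Lemma extension_degree_x : extension_degree (generated_subfield (ff_x E)) 2.
Proof.
rewrite generated_subfield_xE.
pose e (i : 'I_2) : FE := if i == ord0 then 1 else ff_y E; exists e => z.
have sumE (c : {ffun 'I_2 -> FE}) :
    \sum_(i < 2) c i * e i = c ord0 + c (lift ord0 ord0) * ff_y E.
  by rewrite big_ord_recl big_ord1 /e mulr1.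
have zE : z = ff_ratfun (val z)`_0 + ff_ratfun (val z)`_1 * ff_y E.
  apply: val_inj; rewrite [RHS]ratfun_basisE; apply: linear_polyE.
  rewrite -ltnS (leq_trans (size_mk_monic z)) //.
  by rewrite mk_monic_function_field_poly size_function_field_poly.
exists [ffun i : 'I_2 => ff_ratfun (val z)`_i]; split.
  by split=> [i|]; rewrite ?sumE !ffunE //; exists (val z)`_i.
move=> c [cr zc]; apply/ffunP => i; rewrite ffunE.
have [[r _ rE] [s _ sE]] := (cr ord0, cr (lift ord0 ord0)).
move: zc; rewrite sumE -rE -sE => ->; rewrite [val _]ratfun_basisE.
rewrite coef_linear_poly.
case: (unliftP ord0 i) => [j|] -> //.
by rewrite (ord1 j) -sE.
Qed.

End FunctionField.

(** * The curve y^2 = x^3 + 1, and forms in X, Y, Z *)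

Definition curve_j0 (K : fieldType) : weierstrass K := Weierstrass 0 0 0 0 1.

Lemma curve_j0_nonsingular (K : fieldType) :
  (432%:R : K) != 0 -> discriminant (curve_j0 K) != 0.
Proof.
move=> K432; have -> : discriminant (curve_j0 K) = - 432%:R.
  by rewrite /discriminant /=; ring.
by rewrite oppr_eq0.
Qed.

(** [1 ^+ 2] is left unreduced to match the form Y^2 - Z^2 evaluated at Z = 1. *)
Lemma cubic_div_sqr (L : fieldType) (x y : L) :
  x != 0 -> y ^+ 2 = x ^+ 3 + 1 -> x = (y ^+ 2 - 1 ^+ 2) / x ^+ 2.
Proof. by move=> x0 ->; field. Qed.

Lemma div_cubic (L : fieldType) (c x y : L) :
  x != 0 -> y ^+ 2 = x ^+ 3 + 1 -> c / x = c * x ^+ 2 / (y ^+ 2 - 1 ^+ 2).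
Proof. by move=> x0 ->; rewrite expr1n addrK; field. Qed.

Section Forms.
Context {K : fieldType}.

Definition coordinate (i : 'I_3) : mpoly 3 K := mpolyX K (mnm1 i).
Local Notation X := (coordinate 0).
Local Notation Y := (coordinate 1).
Local Notation Z := (coordinate 2).

Lemma coordinate_homog i : coordinate i \is ishomog1 1 mdeg.
Proof. by rewrite dhomogX; apply/eqP; exact: mdeg1. Qed.

Lemma sqr_coordinate_homog i : coordinate i ^+ 2 \is ishomog1 2 mdeg.
Proof. exact: (dhomogMn 2 (coordinate_homog i)). Qed.

Lemma mmap_coordinate (S : comNzRingType) (f : {rmorphism K -> S})
  (v : 'I_3 -> S) i : mmap f v (coordinate i) = v i.
Proof. by rewrite mmapX mmap1U. Qed.

Lemma mmap_sqr (S : comNzRingType) (f : {rmorphism K -> S})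
  (v : 'I_3 -> S) i : mmap f v (coordinate i ^+ 2) = v i ^+ 2.
Proof. by rewrite rmorphXn /= mmap_coordinate. Qed.

Lemma mmap_sqrB (S : comNzRingType) (f : {rmorphism K -> S})
  (v : 'I_3 -> S) i j :
  mmap f v (coordinate i ^+ 2 - coordinate j ^+ 2) = v i ^+ 2 - v j ^+ 2.
Proof. by rewrite rmorphB /= !mmap_sqr. Qed.

End Forms.

(** * The morphisms x and c / x *)

Section Morphisms.
Context {K : fieldType} {Kbar : closedFieldType} (iota : {rmorphism K -> Kbar}).
Hypothesis K432 : (432%:R : K) != 0.

Definition elliptic_j0 : elliptic_curve K :=
  EllipticCurve (curve_j0_nonsingular K432).
Local Notation E := elliptic_j0.

Lemma on_curve_j0 (x y : Kbar) :
  on_curve (geometric_curve iota E) (Affine x y) = (y ^+ 2 == x ^+ 3 + 1).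
Proof. by rewrite /= !rmorph0 rmorph1 !mul0r !addr0. Qed.

Lemma ff_equation_j0 : ff_y E ^+ 2 = ff_x E ^+ 3 + 1.
Proof.
by have := ff_equation (curve_j0 K); rewrite /= !rmorph0 rmorph1 !mul0r !addr0.
Qed.

Definition x_map (P : Defs.point Kbar) : P1 Kbar :=
  if P is Affine x _ then Some x else None.

(** Names the tuple inside [represents], so that its entries are rewritten without unfolding
    K(E). *)
Definition affine_coordinates : 'I_3 -> function_field E :=
  tnth [tuple ff_x E; ff_y E; 1].

Lemma affine_coordinatesE : (affine_coordinates 0 = ff_x E) *
  (affine_coordinates 1 = ff_y E) * (affine_coordinates 2 = 1).
Proof. by []. Qed.

Lemma proj_coord_Infinity : (@proj_coord Kbar Infinity 0 = 0) *
  (@proj_coord Kbar Infinity 1 = 1) * (@proj_coord Kbar Infinity 2 = 0).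
Proof. by []. Qed.

Lemma proj_coord_Affine (x y : Kbar) : (proj_coord (Affine x y) 0 = x) *
  (proj_coord (Affine x y) 1 = y) * (proj_coord (Affine x y) 2 = 1).
Proof. by []. Qed.

(* At infinity x = (y^2 - 1) / x^2. *)
Lemma x_map_regular P : on_curve (geometric_curve iota E) P ->
  exists (d : nat) (F G : mpoly 3 K),
    [/\ F \is ishomog1 d mdeg, G \is ishomog1 d mdeg
      & represents iota (ff_x E) x_map P F G].
Proof.
case: P => [_|x y _].
  exists 2, (coordinate 1 ^+ 2 - coordinate 2 ^+ 2), (coordinate 0 ^+ 2).
  split; [by rewrite rpredB ?sqr_coordinate_homog|
          exact: sqr_coordinate_homog|].
  rewrite /represents -/affine_coordinates !mmap_sqr !mmap_sqrB.
  rewrite !affine_coordinatesE !proj_coord_Infinity.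
  split.
  - split; first by rewrite expf_neq0 ?ff_x_neq0.
    exact: cubic_div_sqr (ff_x_neq0 _) ff_equation_j0.
  - by rewrite !expr0n expr1n subr0 oner_eq0.
  - by rewrite /P1_point expr0n eqxx.
exists 1, (coordinate 0), (coordinate 2); split; try exact: coordinate_homog.
rewrite /represents -/affine_coordinates !mmap_coordinate.
rewrite !affine_coordinatesE !proj_coord_Affine divr1.
by split; rewrite ?oner_neq0 ?oner_eq0 ?andbF // /P1_point oner_eq0 divr1.
Qed.

Definition x_morphism : morphism_P1 iota E := MorphismP1 x_map_regular.

Variable c : K.

Definition inverse_x_map (P : Defs.point Kbar) : P1 Kbar :=
  if P is Affine x _ then P1_point (iota c) x else Some 0.

(* At infinity c / x = c x^2 / (y^2 - 1), since y^2 - 1 = x^3. *)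
Lemma inverse_x_map_regular P : c != 0 -> on_curve (geometric_curve iota E) P ->
  exists (d : nat) (F G : mpoly 3 K),
    [/\ F \is ishomog1 d mdeg, G \is ishomog1 d mdeg
      & represents iota (ff_const E c / ff_x E) inverse_x_map P F G].
Proof.
move=> c0; case: P => [_|x y _].
  exists 2, (c *: coordinate 0 ^+ 2), (coordinate 1 ^+ 2 - coordinate 2 ^+ 2).
  split; [by rewrite dhomogZ ?sqr_coordinate_homog|
          by rewrite rpredB ?sqr_coordinate_homog|].
  rewrite /represents -/affine_coordinates !mmapZ !mmap_sqr !mmap_sqrB.
  rewrite !affine_coordinatesE !proj_coord_Infinity.
  split.
  - split; last exact: div_cubic (ff_x_neq0 _) ff_equation_j0.
    by rewrite ff_equation_j0 expr1n addrK expf_neq0 ?ff_x_neq0.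
  - by rewrite !expr0n expr1n subr0 oner_eq0 andbF.
  - by rewrite /P1_point expr0n expr1n subr0 oner_eq0 mulr0 mul0r.
exists 1, (c *: coordinate 2), (coordinate 0).
split; [by rewrite dhomogZ ?coordinate_homog| exact: coordinate_homog|].
rewrite /represents -/affine_coordinates !mmapZ !mmap_coordinate.
rewrite !affine_coordinatesE !proj_coord_Affine !mulr1.
by split; rewrite ?ff_x_neq0 ?fmorph_eq0 ?(negPf c0).
Qed.

Definition inverse_x_morphism (c0 : c != 0) : morphism_P1 iota E :=
  MorphismP1 (fun P => @inverse_x_map_regular P c0).

Lemma x_morphism_even : even_morphism x_morphism.
Proof. by case. Qed.

Lemma inverse_x_morphism_even (c0 : c != 0) :
  even_morphism (inverse_x_morphism c0).
Proof. by case. Qed.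

Lemma x_morphism_degree : has_degree x_morphism 2.
Proof. exact: extension_degree_x. Qed.

(** c / x and x generate the same subfield of K(E). *)
Lemma inverse_x_morphism_degree (c0 : c != 0) :
  has_degree (inverse_x_morphism c0) 2.
Proof.
rewrite /has_degree /= generated_subfield_inversion ?ff_x_neq0 //.
exact: extension_degree_x.
Qed.

End Morphisms.

(** * Explicit points of order 2, 3, 6 and 4 *)

Section Torsion.
Context {C : numFieldType}.
Local Notation W := (curve_j0 C).

Lemma add_opp_j0 (x y : C) :
  add_point W (Affine x y) (Affine x (- y)) = Infinity.
Proof. by rewrite /= opprK mul0r !subr0 !eqxx. Qed.

(** The slope is a parameter [l] fixed by a product equation, so that its uses leave no quotient of
    coordinates to simplify. *)
Lemma add_chord_j0 (l x1 y1 x2 y2 x3 y3 : C) :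
  x1 != x2 -> l * (x2 - x1) = y2 - y1 -> x3 = l ^+ 2 - x1 - x2 ->
  y3 = - (l * (x3 - x1) + y1) ->
  add_point W (Affine x1 y1) (Affine x2 y2) = Affine x3 y3.
Proof.
move=> x12 lE -> ->; rewrite /= /slope (negPf x12) /=.
have -> : (y2 - y1) / (x2 - x1) = l by rewrite -lE mulfK // subr_eq0 eq_sym.
by congr Affine; ring.
Qed.

Lemma add_tangent_j0 (l x y x3 y3 : C) :
  y != 0 -> l * (2 * y) = 3 * x ^+ 2 -> x3 = l ^+ 2 - x - x ->
  y3 = - (l * (x3 - x) + y) ->
  add_point W (Affine x y) (Affine x y) = Affine x3 y3.
Proof.
move=> y0 lE -> ->; rewrite /= /slope !eqxx /=.
rewrite !mul0r !subr0 mulr0 !mul0r !addr0.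
have y2 : 2 * y != 0 by rewrite mulf_neq0 ?pnatr_eq0.
rewrite -lE mulfK //.
have -> : (y == - y) = false.
  by apply/negbTE; rewrite -subr_eq0 opprK -mulr2n -mulr_natl.
by congr Affine; ring.
Qed.

Lemma torsion2_j0 (c : C) : c ^+ 3 = 1 -> torsion W 2 (Affine (- c) 0).
Proof.
move=> c3; split; first by apply/eqP => /=; ring: c3.
rewrite /muln_point !iterS [iter 0 _ _]/= [add_point _ _ Infinity]/=.
by rewrite -[X in add_point _ _ (Affine _ X)]oppr0 add_opp_j0.
Qed.

(** (0, 1) is a flex with horizontal tangent, so 2P = -P. *)
Lemma torsion3_j0 : torsion W 3 (Affine 0 1).
Proof.
split; first by apply/eqP => /=; ring.
rewrite /muln_point !iterS [iter 0 _ _]/= [add_point _ _ Infinity]/=.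
rewrite (@add_tangent_j0 0 _ _ 0 (- 1)) ?oner_neq0 //; try ring.
exact: add_opp_j0.
Qed.

Lemma torsion6_j0 (c : C) : c ^+ 3 = 1 -> torsion W 6 (Affine (2 * c) 3).
Proof.
move=> c3; have c0 : c != 0 by have := oner_neq0 C; rewrite -c3 expf_eq0.
split; first by apply/eqP => /=; ring: c3.
rewrite /muln_point !iterS [iter 0 _ _]/= [add_point _ _ Infinity]/=.
have c20 : 2 * c != 0 by rewrite mulf_neq0 ?pnatr_eq0.
(* The multiples are 2P = (0, 1), 3P = (-c, 0), 4P = (0, -1) and 5P = (2c, -3) = -P. *)
rewrite (@add_tangent_j0 (2 * c ^+ 2) _ _ 0 1) ?pnatr_eq0 //; try ring: c3.
rewrite (@add_chord_j0 (c ^+ 2) _ _ _ _ (- c) 0) //; try ring: c3.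
rewrite (@add_chord_j0 (c ^+ 2) _ _ _ _ 0 (- 1)) //; try ring: c3; last first.
  by rewrite -subr_eq0 opprK -{2}[c]mul1r -mulrDl mulf_neq0 ?pnatr_eq0.
rewrite (@add_chord_j0 (2 * c ^+ 2) _ _ _ _ (2 * c) (- 3)) //; try ring: c3.
exact: add_opp_j0.
Qed.

(** The abscissa is a root of x^2 + 2 c x - 2 c^2, which makes 2P = (-c, 0) and hence 3P = -P. *)
Lemma torsion4_j0 (c r y : C) :
  c ^+ 3 = 1 -> r ^+ 2 = 3 -> y ^+ 2 = (r - 1) ^+ 3 + 1 ->
  torsion W 4 (Affine (c * (r - 1)) y).
Proof.
move=> c3 r2 y2; have c0 : c != 0 by have := oner_neq0 C; rewrite -c3 expf_eq0.
have n3 : 3 != 0 :> C by rewrite pnatr_eq0.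
have r0 : r != 0 by move: n3; rewrite -r2 expf_eq0.
have yE : y ^+ 2 = 6 * r - 9 by rewrite y2; ring: r2.
have y0 : y != 0.
  suff: y ^+ 2 != 0 by rewrite expf_eq0.
  rewrite yE subr_eq0; apply/eqP => rE.
  (* This would say 108 = 81. *)
  have : (6 * r) ^+ 2 == 9 ^+ 2 by rewrite rE.
  by rewrite exprMn r2 -!natrX -natrM eqr_nat.
split; first by apply/eqP => /=; ring: c3 y2.
rewrite /muln_point !iterS [iter 0 _ _]/= [add_point _ _ Infinity]/=.
(* l = 3 x^2 / (2 y), the slope of the tangent, rewritten by r^2 = 3. *)
pose l := c ^+ 2 * y * r / 3.
rewrite (@add_tangent_j0 l _ _ (- c) 0) //; try by rewrite /l; field: c3 r2 yE.
rewrite (@add_chord_j0 l _ _ _ _ (c * (r - 1)) (- y)) //;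
  try by rewrite /l; field: c3 r2 yE.
  exact: add_opp_j0.
(* The abscissas of P and 2P differ by c r. *)
by rewrite -subr_eq0 opprK mulrBr mulr1 subrK mulf_neq0.
Qed.

End Torsion.

(** * Counting and real cube roots *)

(** An infinite set has measure +oo, above any bound; a finite one has at least as many elements as
    [s]. *)
Lemma le_counting (R : realType) (T : choiceType) (A : set T) (s : seq T) :
  uniq s -> (forall x, x \in s -> A x) ->
  ((size s)%:R%:E <= counting A :> \bar R)%E.
Proof.
move=> us sA; rewrite /counting; case: asboolP => finA; last exact: leey.
rewrite lee_fin ler_nat; apply: uniq_leq_size => // x xs.
by rewrite in_fset_set // mem_set //; exact: sA.
Qed.

(** 4 (x^2 + x y + y^2) = (2 x + y)^2 + 3 y^2 is a sum of squares, zero on reals only at x = y =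
    0. *)
Lemma real_cube_inj (C : numDomainType) (x y : C) :
  x \is Num.real -> y \is Num.real -> x ^+ 3 = y ^+ 3 -> x = y.
Proof.
move=> xr yr xy; apply/eqP; rewrite -subr_eq0; apply: contraT => xy0.
have : (x - y) * ((2 * x + y) ^+ 2 + 3 * y ^+ 2) == 0.
  by apply/eqP; ring: xy.
rewrite mulf_eq0 (negPf xy0) /= paddr_eq0; first last.
- by rewrite mulr_ge0 ?real_exprn_even_ge0.
- by rewrite real_exprn_even_ge0 // rpredD // rpredM // realn.
rewrite sqrf_eq0 mulf_eq0 pnatr_eq0 sqrf_eq0 => /andP[+ /eqP y0].
rewrite y0 addr0 mulf_eq0 pnatr_eq0 /= => /eqP x0.
by rewrite x0 y0 subrr eqxx in xy0.
Qed.

(** * The fourteen common images *)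

Section CommonTorsion.
Variables (C : numClosedFieldType) (w r : C).
Hypotheses (w_prim : 3.-primitive_root w) (r2 : r ^+ 2 = 3).
Hypothesis r_real : r \is Num.real.

Definition unit_roots : seq C := [seq w ^+ i | i <- iota 0 3].
(* Up to cube roots of unity, the images of the points of order 2, 6, 4, 4;
   t |-> -2 / t exchanges the first two and the last two. *)
Definition twists : seq C := [:: -1; 2; r - 1; - r - 1].
(** [None] and the multiples of -1 form x(E[2]); [Some 0] and those of 2 are its image under t |->
    -2 / t; the other two twists give the six images of points of order 4. *)
Definition common_images : seq (P1 C) :=
  [:: None, Some 0 & [seq Some (c * t) | c <- unit_roots, t <- twists]].

Lemma unit_roots_cube c : c \in unit_roots -> c ^+ 3 = 1.
Proof.
by move=> /mapP[i _ ->]; rewrite exprAC (prim_expr_order w_prim) expr1n.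
Qed.

Lemma unit_roots_neq0 c : c \in unit_roots -> c != 0.
Proof.
by move=> /unit_roots_cube c3; have := oner_neq0 C; rewrite -c3 expf_eq0.
Qed.

Lemma uniq_unit_roots : uniq unit_roots.
Proof.
rewrite map_inj_in_uniq ?iota_uniq // => i j; rewrite !mem_iota /= => i3 j3.
by move/eqP; rewrite (eq_prim_root_expr w_prim) /= !modn_small // => /eqP.
Qed.

(** Separates the twists from each other (n = 0, 3) and from zero (n = 1). *)
Lemma sqrt3_neq (n : nat) : (n ^ 2 != 3)%N -> r != n%:R /\ - r != n%:R.
Proof.
move=> n3; have n3C : n%:R ^+ 2 != 3 :> C by rewrite -natrX eqr_nat.
by split; apply: contra_neq n3C => <-; rewrite ?sqrrN.
Qed.

Lemma uniq_twists : uniq twists.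
Proof.
have [[r0 r0'] [r3 r3']] := (sqrt3_neq (isT : (0 ^ 2 != 3)%N),
                             sqrt3_neq (isT : (3 ^ 2 != 3)%N)).
(* Two equal twists would force 1 + 2 = 0, [r] or [- r] equal to 0 or 3, or 2 r = 0. *)
rewrite /= !inE !negb_or !andbT; apply/and3P; split.
- apply/and3P; split.
  + by rewrite -subr_eq0 -opprD oppr_eq0 -(natrD _ 1 2) pnatr_eq0.
  + by apply: contra_neq r0 => e; rewrite -[r](subrK 1) -e; ring.
  + by apply: contra_neq r0' => e; rewrite -[- r](subrK 1) -e; ring.
- apply/andP; split.
  + by apply: contra_neq r3 => e; rewrite -[r](subrK 1) -e; ring.
  + by apply: contra_neq r3' => e; rewrite -[- r](subrK 1) -e; ring.
- apply: contra_neq r0 => e; have /eqP : r *+ 2 = 0.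
    by rewrite mulr2n -[X in X + _](subrK 1) e; ring.
  by rewrite mulrn_eq0 => /eqP.
Qed.

Lemma twists_neq0 t : t \in twists -> t != 0.
Proof.
have [r1 r1'] := sqrt3_neq (isT : (1 ^ 2 != 3)%N).
rewrite !inE => /or4P[] /eqP ->; rewrite ?oppr_eq0 ?oner_eq0 ?pnatr_eq0 //.
  by rewrite subr_eq0.
by rewrite subr_eq0.
Qed.

Lemma twists_real t : t \in twists -> t \is Num.real.
Proof.
by rewrite !inE => /or4P[] /eqP ->; rewrite ?rpredB ?rpredN ?rpred1 ?realn.
Qed.

Lemma common_imagesP p : p \in common_images ->
  [\/ p = None, p = Some 0
    | exists c t, [/\ c \in unit_roots, t \in twists & p = Some (c * t)]].
Proof.
rewrite /common_images 2!in_cons.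
case/or3P=> [/eqP|/eqP|/allpairsP[[c t] [cw tw ->]]].
- by constructor 1.
- by constructor 2.
- by constructor 3; exists c, t.
Qed.

(** Cubing c t = d u removes the roots of unity; the twists are real, so t = u, and cancelling it
    gives c = d. *)
Lemma uniq_common_images : uniq common_images.
Proof.
rewrite /common_images 2!cons_uniq inE negb_or; apply/and3P; split.
- by apply/allpairsP => -[[c t] []].
- apply/allpairsP => -[[c t] [/= cw tw [/esym/eqP]]].
  by rewrite mulf_eq0 (negPf (twists_neq0 tw)) (negPf (unit_roots_neq0 cw)).
rewrite allpairs_uniq ?uniq_unit_roots ?uniq_twists //.
move=> _ _ /allpairsP[[c t] [cw tw ->]] /allpairsP[[d u] [dw uw ->]] /= [e].
rewrite /= in cw tw dw uw.
have tu : t = u.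
  apply: real_cube_inj; rewrite ?twists_real //.
  rewrite -[LHS]mul1r -(unit_roots_cube cw) -exprMn e exprMn.
  by rewrite (unit_roots_cube dw) mul1r.
by rewrite tu; move: e; rewrite tu => /(mulIf (twists_neq0 uw)) ->.
Qed.

Local Notation W := (curve_j0 C).

Lemma twists_torsion c t : c ^+ 3 = 1 -> t \in twists ->
  exists y, all_torsion W (Affine (c * t) y).
Proof.
have all_torsionI n P : torsion W n.+1 P -> all_torsion W P by exists n.+1.
(* Taken at [s] equal to [r] and to [- r]. As c^3 = 1, the same ordinate serves every [c]. *)
have half s : s ^+ 2 = 3 -> c ^+ 3 = 1 ->
    exists y, all_torsion W (Affine (c * (s - 1)) y).
  move=> s2 c3; exists (sqrtC ((s - 1) ^+ 3 + 1)).
  by apply/(all_torsionI 3)/torsion4_j0; rewrite ?sqrtCK.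
move=> c3; rewrite !inE => /or4P[] /eqP ->.
- by exists 0; rewrite mulrN1; apply/(all_torsionI 1)/torsion2_j0.
- by exists 3; rewrite mulrC; apply/(all_torsionI 5)/torsion6_j0.
- exact: half.
- by apply: half; rewrite ?sqrrN.
Qed.


Lemma all_torsion_Infinity : all_torsion W Infinity.
Proof. by exists 1%N. Qed.

Lemma all_torsion_x0 : all_torsion W (Affine 0 1).
Proof. by exists 3%N => //; exact: torsion3_j0. Qed.

Hypotheses (C432 : 432%:R != 0 :> C) (C2 : -2 != 0 :> C).
Local Notation pi1 := (x_morphism idfun C432).
Local Notation pi2 := (inverse_x_morphism idfun C432 C2).

Lemma common_images_x p : p \in common_images -> all_torsion_image pi1 p.
Proof.
move=> /common_imagesP[->|->|[c [t [cw tw ->]]]].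
- by exists Infinity => //; exact: all_torsion_Infinity.
- by exists (Affine 0 1) => //; exact: all_torsion_x0.
have [y cty] := twists_torsion (unit_roots_cube cw) tw.
by exists (Affine (c * t) y).
Qed.

Lemma twists_inversion t : t \in twists -> - 2 / t \in twists.
Proof.
move=> tw; have t0 := twists_neq0 tw.
suff [u uw tu] : exists2 u, u \in twists & u * t = -2.
  by rewrite -tu mulfK.
move: tw; rewrite !inE => /or4P[] /eqP ->.
- by exists 2; [rewrite !inE eqxx orbT | ring].
- by exists (-1); [rewrite !inE eqxx | ring].
(* (r - 1)(- r - 1) = 1 - r^2 = -2. *)
- by exists (- r - 1); [rewrite !inE eqxx !orbT | ring: r2].
- by exists (r - 1); [rewrite !inE eqxx !orbT | ring: r2].
Qed.

Lemma common_images_inverse_x p :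
  p \in common_images -> all_torsion_image pi2 p.
Proof.
move=> /common_imagesP[->|->|[c [t [cw tw ->]]]].
- exists (Affine 0 1); first exact: all_torsion_x0.
  by rewrite /= /P1_point eqxx.
- by exists Infinity => //; exact: all_torsion_Infinity.
have c3 := unit_roots_cube cw; have c0 := unit_roots_neq0 cw.
have t0 := twists_neq0 tw.
(* -2 / x = c t has the solution x = c^-1 (-2 / t), again a cube root of unity times a twist. *)
have ci3 : c^-1 ^+ 3 = 1 by rewrite exprVn c3 invr1.
have [y cty] := twists_torsion ci3 (twists_inversion tw).
exists (Affine (c^-1 * (- 2 / t)) y) => //=.
have it0 := twists_neq0 (twists_inversion tw).
rewrite /P1_point mulf_eq0 invr_eq0 (negPf c0) (negPf it0).
by congr Some; field; rewrite t0 c0.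
Qed.

Lemma le_counting_common_images (R : realType) :
  (14%:R%:E <= counting (all_torsion_image pi1 `&` all_torsion_image pi2)
    :> \bar R)%E.
Proof.
apply: (@le_counting _ _ _ common_images); first exact: uniq_common_images.
by move=> p pc; split;
  [exact: common_images_x | exact: common_images_inverse_x].
Qed.

(** Infinity separates the two images: [pi2] takes it only at x = 0, where y^2 = 1, while affine
    2-torsion has y = 0. *)
Lemma torsion_image2_neq : torsion_image pi1 2 <> torsion_image pi2 2.
Proof.
move=> e; have : torsion_image pi2 2 None.
  by rewrite -e; exists Infinity.
case=> -[|x y] [xy tor2] //=; rewrite /P1_point; case: eqP => // x0 _.
move: xy tor2; rewrite x0 on_curve_j0 expr0n add0r => /eqP y2.
rewrite /muln_point !iterS [iter 0 _ _]/= [add_point _ _ Infinity]/=.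
rewrite /= eqxx mulr0 !subr0; case: eqP => // yN.
have : 2 * y = 0 by rewrite mulr_natl mulr2n {2}yN subrr.
move/eqP; rewrite mulf_eq0 pnatr_eq0 /= => /eqP y0.
by move/eqP: y2; rewrite y0 expr0n eq_sym oner_eq0.
Qed.

End CommonTorsion.

(** * The lower bound for the supremum *)

Local Open Scope ereal_scope.

(* An algebraic closure Kbar of K is part of the data; it is unique up to
   isomorphism over K, so the cardinalities do not depend on it. *)
Theorem theorem18 (R : realType) :
  14%:R%:E <= ereal_sup [set c : \bar R |
    exists (K : fieldType) (Kbar : closedFieldType)
      (iota : {rmorphism K -> Kbar}) (E1 E2 : elliptic_curve K)
      (pi1 : morphism_P1 iota E1) (pi2 : morphism_P1 iota E2),
      [/\ [pchar K] =i pred0 /\ is_algebraic_closure iota,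
          even_morphism pi1 /\ has_degree pi1 2,
          even_morphism pi2 /\ has_degree pi2 2,
          torsion_image pi1 2 <> torsion_image pi2 2
        & c = counting (all_torsion_image pi1 `&` all_torsion_image pi2)]].
Proof.
have C432 : (432%:R != 0 :> algC)%R by rewrite pnatr_eq0.
have C2 : (-2 != 0 :> algC)%R by rewrite oppr_eq0 pnatr_eq0.
have [w w_prim] := C_prim_root_exists (isT : (0 < 3)%N).
have r_real : (sqrtC 3 : algC)%R \is Num.real.
  by rewrite ger0_real // sqrtC_ge0 ler0n.
have := le_counting_common_images w_prim (sqrtCK _) r_real C432 C2 R.
move=> /le_trans; apply; apply: ereal_sup_ubound.
(* The algebraic numbers serve both as [K] and as its closure. *)
exists algC, algC, idfun, (elliptic_j0 C432), (elliptic_j0 C432).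
exists (x_morphism idfun C432), (inverse_x_morphism idfun C432 C2).
split=> //.
- by split; [exact: pchar_num | move=> z; exact: algebraic_id].
- by split; [exact: x_morphism_even | exact: x_morphism_degree].
- by split; [exact: inverse_x_morphism_even | exact: inverse_x_morphism_degree].
- exact: torsion_image2_neq.
Qed.
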